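(* Let $G$ be a graph with two vertices $u$ and $v$ such that $|N(u)|-1=|N(v)|$. If $G$ has a unique vertex $x$ with $x\in N(u)$ and $x\notin N(v)$, then $G$ is not group vertex magic.
   Context: Graphs are finite, simple and undirected; $N(v)$ is the open neighborhood of $v$; in this part of the paper all Abelian groups are finite. For an additive Abelian group $\Gamma$ with identity $0$ and a graph $G$, a $\Gamma$-vertex magic labeling is a map $\ell:V(G)\to\Gamma\setminus\{0\}$ for which there is $\mu\in\Gamma$ with $w(v)=\sum_{y\in N(v)}\ell(y)=\mu$ for every vertex $v$; $G$ is group vertex magic if it is $\Gamma$-vertex magic for every nontrivial Abelian group $\Gamma$. *)

(* Defs.v *)
From HB Require Import structures.
From mathcomp Require Import all_boot all_order all_algebra.
Set Implicit Arguments.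
Unset Strict Implicit.
Unset Printing Implicit Defensive.
Import GRing.Theory.
Local Open Scope ring_scope.

Record sgraph := SGraph {
  vertex :> finType;
  adj : rel vertex;
  adj_sym : symmetric adj;
  adj_irrefl : irreflexive adj }.

Definition nbhd (G : sgraph) (v : G) : {set G} := [set y | adj v y].

Definition weight (Gamma : finZmodType) (G : sgraph) (l : G -> Gamma) (v : G) :
    Gamma :=
  \sum_(y in nbhd v) l y.

Definition vertex_magic_labeling (Gamma : finZmodType) (G : sgraph)
    (l : G -> Gamma) : Prop :=
  (forall v : G, l v != 0) /\
  exists mu : Gamma, forall v : G, weight l v = mu.

Definition vertex_magic (Gamma : finZmodType) (G : sgraph) : Prop :=
  exists l : G -> Gamma, vertex_magic_labeling l.

(* Only finite Abelian groups are considered, hence finZmodType. *)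
Definition group_vertex_magic (G : sgraph) : Prop :=
  forall Gamma : finZmodType, (1 < #|Gamma|)%N -> vertex_magic Gamma G.

(* Main.v *)
Require Import Defs.
From mathcomp Require Import all_boot all_order all_algebra.

(** The cardinality condition forces $N(v)\subseteq N(u)$, so $N(u)$ is the disjoint union of $N(v)$
    and $\{x\}$ ([nbhd_eq_setU1]). Hence $w(u)=\ell(x)+w(v)$ for every labeling ([weight_setU1]),
    and equal weights would force the forbidden label $\ell(x)=0$. *)

Lemma nbhd_eq_setU1 (G : sgraph) (u v x : G) :
    #|nbhd u| = #|nbhd v| + 1 ->
    nbhd u :\: nbhd v = [set x] ->
  x \notin nbhd v /\ nbhd u = x |: nbhd v.
Proof.
move=> hcard hD.
have /setDP[_ xv]: x \in nbhd u :\: nbhd v by rewrite hD set11.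
split=> //.
(* Removing the single element $x$ from $N(u)$ leaves $|N(v)|$ elements, all in $N(v)$; they
   therefore exhaust $N(v)$. *)
have hI: #|nbhd u :&: nbhd v| = #|nbhd v|.
  by have := cardsID (nbhd v) (nbhd u); rewrite hD cards1 hcard => /addIn.
have /setIidPr hvu: nbhd v \subset nbhd u.
  rewrite -(_ : nbhd u :&: nbhd v = nbhd v) ?subsetIl //.
  by apply/eqP; rewrite eqEcard subsetIr hI leqnn.
by rewrite -{1}(setID (nbhd u) (nbhd v)) hD hvu setUC.
Qed.

Lemma weight_setU1 (Gamma : finZmodType) (G : sgraph) (l : G -> Gamma)
    (u v x : G) :
    x \notin nbhd v -> nbhd u = x |: nbhd v ->
  weight l u = (l x + weight l v)%R.
Proof. by move=> xv huv; rewrite /weight huv big_setU1. Qed.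

Theorem theorem2p2 (G : sgraph) (u v : G)
    (hcard : #|nbhd u| = #|nbhd v| + 1)
    (hx : exists! x : G, x \in nbhd u /\ x \notin nbhd v) :
  ~ group_vertex_magic G.
Proof.
move=> hG; case: hx => x [[xu xv] x_uniq].
have hD: nbhd u :\: nbhd v = [set x].
  apply/setP=> y; rewrite in_set1; apply/setDP/eqP=> [hy | -> //].
  by rewrite (x_uniq y hy).
have [_ huv] := nbhd_eq_setU1 _ _ _ _ hcard hD.
(* The choice of ['Z_2] is arbitrary: the contradiction arises in any nontrivial group. *)
have [|l [l_neq0 [mu hmu]]] := hG 'Z_2; first by rewrite card_ord.
(* Both weights are $\mu$, so $\mu=\ell(x)+\mu$; cancel $\mu$. *)
have := weight_setU1 _ _ l _ _ _ xv huv; rewrite !hmu => /eqP.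
by rewrite -GRing.subr_eq GRing.subrr eq_sym (negPf (l_neq0 x)).
Qed.
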